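(* Let $X$ be locally compact, let $\rho$ be a d-functional with domain $D(\rho)$, $C_c(X)\subseteq D(\rho)\subseteq C_b(X)$, and let $\mu_\rho:\mathscr{O}(X)\cup\mathscr{C}(X)\to[0,\infty]$ be given by $$\mu_\rho(U)=\sup\{\rho(f): f\in C_c(X),\ 0\le f\le1,\ \operatorname{supp} f\subseteq U\}\quad (U\in\mathscr{O}(X)),$$ $$\mu_\rho(F)=\inf\{\mu_\rho(U): F\subseteq U,\ U\in\mathscr{O}(X)\}\quad (F\in\mathscr{C}(X)).$$ Then: (i) $\mu_\rho$ is a deficient topological measure. (ii) If $\rho$ is real-valued on $C_c(X)$, then $\mu_\rho$ is compact-finite, i.e. $\mu_\rho(K)<\infty$ for every compact $K$. (iii) If $\rho$ is bounded, then $\mu_\rho$ is finite, i.e. $\mu_\rho(X)<\infty$. (iv) If $X$ is compact and $D(\rho)=C(X)$, then $\mu_\rho(X)=\rho(1)$. (v) If $D(\rho)$ includes constants, $\rho(1)\in\mathbb{R}$, and $\rho$ is an s-functional satisfying the constant condition $\rho(g+c)=\rho(g)+\rho(c)$ for every $g\in D(\rho)$ and every constant $c$, then $\mu_\rho$ is a topological measure. (vi) If $\rho$ is a quasi-linear functional, then $\mu_\rho$ is a topological measure.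
   Context: $X$ is a locally compact connected space; $\mathscr{O}(X),\mathscr{C}(X),\mathscr{K}(X)$ are the families of open, closed, compact subsets of $X$. $C(X)$, $C_b(X)$, $C_c(X)$: real continuous functions on $X$ that are, respectively, arbitrary, bounded, of compact support (uniform norm). $\operatorname{supp} f=\overline{\{x: f(x)\ne0\}}$. A functional with values in $[-\infty,\infty]$ attains at most one of $\infty,-\infty$ and is not identically $\infty$ or $-\infty$. A functional $\rho$ with values in $[-\infty,\infty]$ and $|\rho(0)|<\infty$ is a d-functional if for $f,g\in D(\rho)$: $f\ge0$, $a>0$ imply $\rho(af)=a\rho(f)$; $0\le g\le f$ implies $\rho(g)\le\rho(f)$; $fg=0$, $f,g\ge0$ imply $\rho(f+g)=\rho(f)+\rho(g)$. A real-valued functional $\rho$ is an s-functional if: $f\ge0$, $a\in\mathbb{R}$ imply $\rho(af)=a\rho(f)$; $0\le g\le f$ implies $\rho(g)\le\rho(f)$; and $\rho(f+g)=\rho(f)+\rho(g)$ whenever $fg=0$ and either $f,g\ge0$ or $f\ge0,g\le0$. A quasi-linear functional is a real-valued map $\rho$ on a subalgebra $\mathcal{B}$ of $C(X)$ containing $C_c(X)$ (here $\mathcal{B}=D(\rho)$) with: $\rho(af)=a\rho(f)$ for $a\in\mathbb{R}$; for each $h\in\mathcal{B}$, $\rho(f+g)=\rho(f)+\rho(g)$ for $f,g$ in the singly generated subalgebra generated by $h$, i.e. the smallest closed subalgebra of $\mathcal{B}$ containing $h$ (for $X$ compact and $\mathcal{B}=C(X)$, containing $h$ and $1$); $f\ge0$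 implies $\rho(f)\ge0$. $\rho$ is bounded if $\|\rho\|=\sup\{|\rho(f)|:\|f\|\le1\}<\infty$. A deficient topological measure on $X$ is a set function $\nu:\mathscr{C}(X)\cup\mathscr{O}(X)\to[0,\infty]$ such that: (1) $\nu(C\sqcup K)=\nu(C)+\nu(K)$ for disjoint $C,K\in\mathscr{K}(X)$; (2) $\nu(U)=\sup\{\nu(C): C\subseteq U,\ C\in\mathscr{K}(X)\}$ for open $U$; (3) $\nu(F)=\inf\{\nu(U): F\subseteq U,\ U\in\mathscr{O}(X)\}$ for closed $F$. A topological measure is a set function $\mu:\mathscr{C}(X)\cup\mathscr{O}(X)\to[0,\infty]$ satisfying (2), (3) and, instead of (1): if $A,B,A\sqcup B\in\mathscr{K}(X)\cup\mathscr{O}(X)$ then $\mu(A\sqcup B)=\mu(A)+\mu(B)$ ($\sqcup$ denotes disjoint union). *)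

(* Defs.v *)
From HB Require Import structures.
From mathcomp Require Import all_boot all_order all_algebra.
From mathcomp Require Import all_classical all_reals all_analysis.

Set Implicit Arguments.
Unset Strict Implicit.
Unset Printing Implicit Defensive.

Import Order.TTheory GRing.Theory Num.Theory.
Import numFieldNormedType.Exports.

Local Open Scope classical_set_scope.
Local Open Scope ring_scope.
Local Open Scope ereal_scope.

Section FunctionSpaces.
Context {R : realType} {X : topologicalType}.
Implicit Types (f g : X -> R) (D : set (X -> R)).

Definition fsupp f : set X := closure [set x | f x != 0%R].

Definition Cfun : set (X -> R) := [set f | continuous f].

Definition Cb : set (X -> R) :=
  [set f | continuous f /\ exists M : R, forall x, (`|f x| <= M)%R].

Definition Cc : set (X -> R) := [set f | continuous f /\ compact (fsupp f)].

Definition fle f g : Prop := forall x, (f x <= g x)%R.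

(* Over an empty X this is -oo, which does not affect the test
   [unorm f <= 1] below. *)
Definition unorm f : \bar R := ereal_sup [set `|(f x)%:E| | x in [set: X]].

Definition subalgebra D : Prop :=
  [/\ D (cst 0%R),
      forall f g, D f -> D g -> D (f \+ g)%R,
      forall f g, D f -> D g -> D (f \* g)%R
    & forall (a : R) f, D f -> D (fun x => a * f x)%R].

(* Relative closedness, for the topology of uniform convergence on X. *)
Definition uclosed_in (B A : set (X -> R)) : Prop :=
  B `&` closure (A : set {uniform X -> R}) `<=` A.

(* The intersection of all closed subalgebras of B containing h (and the
   constant 1 when X is compact and B is all of C(X)). *)
Definition gen_subalgebra (B : set (X -> R)) (h : X -> R) : set (X -> R) :=
  [set f | forall A : set (X -> R),
     A `<=` B -> subalgebra A -> uclosed_in B A -> A h ->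
     (compact [set: X] -> B = Cfun -> A (cst 1%R)) -> A f].

End FunctionSpaces.

(* A functional with domain D is a total function rho on X -> R, of which only
   the restriction to D matters.  In the definitions of d-functionals and
   s-functionals, D is an arbitrary set of functions, and an identity involving
   rho (a f) or rho (f + g) is required when a f, respectively f + g, is
   in D. *)
Section Functionals.
Context {R : realType} {X : topologicalType}.
Variables (D : set (X -> R)) (rho : (X -> R) -> \bar R).

Definition functional : Prop :=
  [/\ ~ ((exists2 f, D f & rho f = +oo) /\ (exists2 f, D f & rho f = -oo)),
      ~ (forall f, D f -> rho f = +oo)
    & ~ (forall f, D f -> rho f = -oo)].

Definition real_valued_on (E : set (X -> R)) : Prop :=
  forall f, E f -> rho f \is a fin_num.

Definition d_functional : Prop :=
  [/\ functional,
      D (cst 0%R) /\ `|rho (cst 0%R)| < +oo,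
      forall f (a : R), D f -> fle (cst 0%R) f -> (0 < a)%R ->
        D (fun x => a * f x)%R -> rho (fun x => a * f x)%R = a%:E * rho f,
      forall f g, D f -> D g -> fle (cst 0%R) g -> fle g f -> rho g <= rho f
    & forall f g, D f -> D g -> (forall x, f x * g x = 0)%R ->
        fle (cst 0%R) f -> fle (cst 0%R) g ->
        D (f \+ g)%R -> rho (f \+ g)%R = rho f + rho g].

Definition s_functional : Prop :=
  [/\ real_valued_on D,
      forall f (a : R), D f -> fle (cst 0%R) f ->
        D (fun x => a * f x)%R -> rho (fun x => a * f x)%R = a%:E * rho f,
      forall f g, D f -> D g -> fle (cst 0%R) g -> fle g f -> rho g <= rho f
    & forall f g, D f -> D g -> (forall x, f x * g x = 0)%R ->
        (fle (cst 0%R) f /\ fle (cst 0%R) g) \/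
        (fle (cst 0%R) f /\ fle g (cst 0%R)) ->
        D (f \+ g)%R -> rho (f \+ g)%R = rho f + rho g].

(* Here g + c must be in D: otherwise the condition would say nothing when,
   say, X is not compact and D consists of Cc and the constants. *)
Definition constant_condition : Prop :=
  forall g (c : R), D g ->
    D (g \+ cst c)%R /\ rho (g \+ cst c)%R = rho g + rho (cst c).

Definition quasi_linear_functional : Prop :=
  [/\ [/\ subalgebra D, D `<=` Cfun & Cc `<=` D],
      real_valued_on D,
      forall f (a : R), D f -> rho (fun x => a * f x)%R = a%:E * rho f,
      forall h f g, D h -> gen_subalgebra D h f -> gen_subalgebra D h g ->
        rho (f \+ g)%R = rho f + rho g
    & forall f, D f -> fle (cst 0%R) f -> 0 <= rho f].

Definition functional_norm : \bar R :=
  ereal_sup [set `|rho f| | f in [set f | D f /\ unorm f <= 1]].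

Definition bounded_functional : Prop := functional_norm < +oo.

End Functionals.

(* The set functions below live on open and closed sets; as total functions on
   [set X], their values on other sets are irrelevant. *)
Section SetFunctions.
Context {R : realType} {X : topologicalType}.
Variable nu : set X -> \bar R.

Definition nonneg_set_function : Prop :=
  forall A : set X, open A \/ closed A -> 0 <= nu A.

Definition inner_compact_regular : Prop :=
  forall U : set X, open U ->
    nu U = ereal_sup [set nu C | C in [set C | compact C /\ C `<=` U]].

Definition outer_open_regular : Prop :=
  forall F : set X, closed F ->
    nu F = ereal_inf [set nu U | U in [set U | open U /\ F `<=` U]].

Definition deficient_topological_measure : Prop :=
  [/\ nonneg_set_function,
      forall C K : set X, compact C -> compact K -> C `&` K = set0 ->
        nu (C `|` K) = nu C + nu K,
      inner_compact_regular
    & outer_open_regular].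

Definition topological_measure : Prop :=
  [/\ nonneg_set_function,
      forall A B : set X, compact A \/ open A -> compact B \/ open B ->
        compact (A `|` B) \/ open (A `|` B) -> A `&` B = set0 ->
        nu (A `|` B) = nu A + nu B,
      inner_compact_regular
    & outer_open_regular].

End SetFunctions.

Section MuRho.
Context {R : realType} {X : topologicalType}.
Variable rho : (X -> R) -> \bar R.

Definition mu_open (U : set X) : \bar R :=
  ereal_sup [set rho f | f in [set f |
    [/\ Cc f, fle (cst 0%R) f, fle f (cst 1%R) & fsupp f `<=` U]]].

Definition mu_rho (A : set X) : \bar R :=
  if `[< open A >] then mu_open A
  else ereal_inf [set mu_open U | U in [set U | open U /\ A `<=` U]].

Lemma mu_rho_openE (U : set X) : open U -> mu_rho U = mu_open U.
Proof. by move=> oU; rewrite /mu_rho asboolT. Qed.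

(* Both formulas agree on sets that are open and closed. *)
Lemma mu_rho_closedE (F : set X) : closed F ->
  mu_rho F = ereal_inf [set mu_rho U | U in [set U | open U /\ F `<=` U]].
Proof.
move=> _; have -> : [set mu_rho U | U in [set U | open U /\ F `<=` U]] =
    [set mu_open U | U in [set U | open U /\ F `<=` U]].
  by apply/seteqP; split=> y [U [oU FU] <-]; exists U => //; rewrite mu_rho_openE.
rewrite /mu_rho; case: asboolP => // oF; apply/eqP; rewrite eq_le.
apply/andP; split; last by apply: ereal_inf_lbound; exists F => //; split.
apply: le_ereal_inf_tmp => _ [U [oU FU] <-].
apply: ereal_sup_le => _ [f [cf f0 f1 fF] <-]; exists f => //.
by split=> //; apply: subset_trans fF FU.
Qed.

End MuRho.

(* Main.v *)
Require Import Defs.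
From mathcomp Require Import all_boot all_order all_algebra.
From mathcomp Require Import all_classical all_reals all_analysis.
From mathcomp Require Import ring lra.
Set Implicit Arguments.
Unset Strict Implicit.
Unset Printing Implicit Defensive.

Import Order.TTheory GRing.Theory Num.Theory.
Import numFieldNormedType.Exports.
Local Open Scope classical_set_scope.
Local Open Scope ring_scope.
Local Open Scope ereal_scope.

(** Functions in [Cc] see a locally compact Hausdorff space well enough to
    separate a compact set from the complement of an open one
    ([lch_urysohn]), and every claim reduces to a choice of such functions.

    Deficient topological measure.  A function supported in the union of two
    disjoint open sets is the sum of its restrictions to them, which are
    continuous and have product 0; hence [mu_open] is additive on disjoint open
    sets ([mu_openU]), and taking infima over neighbourhoods gives additivity on
    disjoint compact sets ([mu_rho_compactU]).  Inner regularity holds because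
    [rho f] is at most the value of [mu_rho] on the compact support of [f], and
    outer regularity is the definition.

    Topological measure.  What is missing is the additivity for a compact [K]
    and an open [V] that are disjoint, and this comes down to
    [mu U <= mu C + mu (U \ C)] for [C] compact inside [U] open
    ([mu_open_split]).  To get it, bound a function supported in [U] by a cutoff
    [phi], and choose a smaller cutoff [g] which is 1 near [C], is supported in a
    given neighbourhood of [C], and such that [phi] = 1 on the support of [g].  Then
    [phi - g] is supported in [U \ C], so the inequality follows from
    [rho phi = rho g + rho (phi - g)].  This single identity
    ([plateau_additive]) is what the extra hypotheses on [rho] provide:

    - for an s-functional with the constant condition, [1 - phi] and [g] are
      nonnegative with product 0 and their sum is [1 - (phi - g)], so
      orthogonal additivity applies once the constant 1 is split off;

    - for a quasi-linear functional, [phi] and [g] both lie in the subalgebra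
      generated by [h = phi + g].  Indeed [h <= 1] where [g] vanishes and
      [h = 1 + g] elsewhere, so [phi - g = 1 - |1 - h|], and the tent function
      [1 - |1 - t|] is a uniform limit on [0, 2] of polynomials without
      constant term ([tent_poly_cvg]). *)

(** * Sums with a supremum or an infimum of nonnegative extended reals *)

(** The nonnegativity hypotheses, here and in the next lemma, keep the sums away
    from +oo - oo, so that the case of an infinite [t] is trivial. *)
Lemma ge0_ereal_supD_le (R : realType) (S : set (\bar R)) (t M : \bar R) :
  S !=set0 -> (forall s, S s -> 0 <= s) -> 0 <= t ->
  (forall s, S s -> s + t <= M) -> ereal_sup S + t <= M.
Proof.
move=> [s0 Ss0] S0; case: t => [t t0 H|_ H|//].
  rewrite -leeBrDr//; apply: ge_ereal_sup => s Ss.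
  by rewrite leeBrDr//; exact: H.
have := H _ Ss0; rewrite addey; last by have := S0 _ Ss0; case: (s0).
by rewrite leye_eq => /eqP ->; rewrite leey.
Qed.

Lemma ge0_ereal_infD_ge (R : realType) (S : set (\bar R)) (t M : \bar R) :
  (forall s, S s -> 0 <= s) -> 0 <= t ->
  (forall s, S s -> M <= s + t) -> M <= ereal_inf S + t.
Proof.
move=> S0; case: t => [t t0 H|_ H|//].
  rewrite -leeBlDr//; apply: le_ereal_inf_tmp => s Ss.
  by rewrite leeBlDr//; exact: H.
have : 0 <= ereal_inf S by apply: le_ereal_inf_tmp => s; exact: S0.
by move=> inf0; rewrite addey ?leey//; case: (ereal_inf S) inf0.
Qed.

(** * Functions with compact support and Urysohn's lemma *)

Section test_functions.
Context {R : realType} {X : topologicalType}.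
Implicit Types (f g : X -> R) (K U V : set X).

Definition test_fun U : set (X -> R) :=
  [set f | [/\ Cc f, fle (cst 0%R) f, fle f (cst 1%R) & fsupp f `<=` U]].

Lemma fsupp_sub f K : closed K -> (forall x, f x != 0%R -> K x) ->
  fsupp f `<=` K.
Proof. by move=> cK fK; rewrite /fsupp (closure_id K).1//; exact: closureS. Qed.

Lemma notin_fsupp f x : ~ fsupp f x -> f x = 0%R.
Proof.
by move=> sx; apply/eqP/negPn/negP => fx; apply: sx; exact: subset_closure.
Qed.

Lemma CcP f K : continuous f -> compact K -> fsupp f `<=` K -> Cc f.
Proof.
by move=> cf cK fK; split=> //; apply: subclosed_compact fK => //; exact: closed_closure.
Qed.

Lemma Cc_add f g : Cc f -> Cc g -> Cc (f \+ g)%R.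
Proof.
move=> [cf sf] [cg sg]; apply: (CcP _ (compactU sf sg)).
  by move=> x; apply: cvgD; [exact: cf|exact: cg].
apply: fsupp_sub; first by apply: closedU; exact: closed_closure.
move=> x; apply: contraNP => /not_orP[/notin_fsupp fx /notin_fsupp gx].
by rewrite /= fx gx addr0.
Qed.

Lemma Cc_scale f (a : R) : Cc f -> Cc (fun x => a * f x)%R.
Proof.
move=> [cf sf]; apply: (CcP _ sf).
  by move=> x; apply: cvgM; [exact: cvg_cst|exact: cf].
apply: fsupp_sub; first exact: closed_closure.
by move=> x; apply: contraNP => /notin_fsupp ->; rewrite mulr0.
Qed.

Lemma Cc_sub f g : Cc f -> Cc g -> Cc (f \- g)%R.
Proof.
move=> cf cg; have -> : (f \- g = f \+ (fun x => -1 * g x))%R.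
  by apply/funext => x /=; rewrite mulN1r.
by apply: Cc_add => //; exact: Cc_scale.
Qed.

Lemma test_fun0 U : test_fun U (cst 0%R).
Proof.
have supp0 : fsupp (cst 0%R : X -> R) `<=` set0.
  by apply: fsupp_sub => [|x]; [exact: closed0|by rewrite /= eqxx].
split; last by apply: subset_trans supp0 _.
- by apply: (CcP _ (@compact0 X)) => //; exact: cst_continuous.
- by move=> x /=.
- by move=> x /=; exact: ler01.
Qed.

Lemma continuous_near_eq f :
  (forall x : X, exists2 g, continuous g & \forall y \near x, g y = f y) ->
  continuous f.
Proof.
move=> H x; have [g cg gf] := H x; rewrite /continuous_at -(nbhs_singleton gf).
by apply: cvg_trans (cg x); exact: near_eq_cvg gf.
Qed.

End test_functions.

(** The one-point compactification is compact Hausdorff, hence normal, which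
    provides a continuous [f] equal to 1 on [K] and to 0 off [U], in particular
    at infinity.  Clamping [3 f - 1] between 0 and 1 then gives a function
    whose support is contained in the compact subset [f >= 1/3] of [U], and
    which is 1 on the open set [f > 2/3], not merely on [K]. *)
Lemma lch_urysohn (R : realType) (X : topologicalType) (K U : set X) :
  hausdorff_space X -> locally_compact [set: X] ->
  compact K -> open U -> K `<=` U ->
  exists g : X -> R, exists W, [/\ test_fun U g, open W, K `<=` W &
    forall x, W x -> g x = 1%R].
Proof.
move=> hX lX cK oU KU.
pose Y := one_point_compactification X; pose s : X -> Y := Some.
have cs : continuous s by exact: one_point_compactification_some_continuous.
have hY : hausdorff_space Y by exact: one_point_compactification_hausdorff.
have nY : normal_space Y.
  by apply: compact_normal => //; exact: one_point_compactification_compact.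
have cA : closed (~` (s @` U)).
  by apply: open_closedC; exact: one_point_compactification_open_some.
have cB : closed (s @` K).
  apply: compact_closed => //; apply: continuous_compact => //.
  exact: continuous_subspaceT.
have AB : ~` (s @` U) `&` (s @` K) = set0.
  apply/seteqP; split=> // y [nU [x Kx sxy]]; apply: nU; exists x => //.
  exact: KU.
have /(@uniform_separatorP _ R)[f [cf f01 f0 f1]] :=
  normal_uniform_separator nY cA cB AB.
have fE x : (0 <= f x <= 1)%R by have := f01 (f x); rewrite /= in_itv/=; apply; exists x.
have fs0 x : ~ U x -> f (s x) = 0%R.
  by move=> nU; apply: f0; exists (s x) => //; move=> [y Uy yx]; apply: nU; case: yx => <-.
have fN0 : f None = 0%R by apply: f0; exists None => //; move=> [y _].
have cfs : continuous (f \o s).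
  by move=> x; apply: continuous_comp; [exact: cs|exact: cf].
pose F := [set x | (1/3 <= f (s x))%R].
have cF : closed F.
  by apply: (@closed_comp _ _ (f \o s) [set t | (1/3 <= t)%R]) => //; exact: closed_ge.
have FU : F `<=` U.
  by move=> x; apply: contraPP => /fs0; rewrite /F /= => ->; apply/negP; lra.
(* [f] vanishes at infinity, so [f < 1/3] is a neighbourhood of infinity,
   that is, it contains the complement of a compact set. *)
have kF : compact F.
  have : nbhs (None : Y) [set y | (f y < 1/3)%R].
    have : open [set y | (f y < 1/3)%R].
      by apply: (@open_comp _ _ f [set t | (t < 1/3)%R]) => //; exact: open_lt.
    by rewrite openE => /(_ None); rewrite /interior/=; apply; rewrite fN0; lra.
  move=> [W [kW cW] WF]; apply: subclosed_compact kW _ => // x.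
  apply: contraPP => nW; rewrite /F /=; apply/negP; rewrite -ltNge.
  by apply: (WF (s x)); left; exists x.
pose g x := Order.max 0%R (Order.min 1%R (3 * f (s x) - 1)%R).
have gF : fsupp g `<=` F.
  apply: fsupp_sub => // x; apply: contraNP => /negP; rewrite -ltNge => fx.
  rewrite /g; apply/eqP; rewrite min_r; last lra.
  by rewrite max_l//; lra.
exists g, [set x | (2/3 < f (s x))%R]; split.
- split.
  + apply: (CcP _ kF gF) => x; apply: (@continuous_max R X (cst 0%R)
      (fun x => Order.min 1%R (3 * f (s x) - 1)%R)); first exact: cvg_cst.
    apply: (@continuous_min R X (cst 1%R) (fun x => (3 * f (s x) - 1)%R)).
      exact: cvg_cst.
    apply: cvgB; last exact: cvg_cst.
    by apply: cvgM; [exact: cvg_cst|exact: cfs].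
  + by move=> x; rewrite /g /= le_max lexx.
  + by move=> x; rewrite /g /= ge_max ler01/= ge_min lexx.
  + exact: subset_trans gF FU.
- by apply: (@open_comp _ _ (f \o s) [set t | (2/3 < t)%R]) => //; exact: open_gt.
- move=> x Kx /=; rewrite (_ : f (s x) = 1%R); first by lra.
  by apply: f1; exists (s x) => //; exists x.
- move=> x /= fx; rewrite /g min_l; last by lra.
  by rewrite max_r.
Qed.

(** * The deficient topological measure *)

(** The part of the definition of a d-functional that the set function depends
    on, freed from the domain: only values on [Cc] enter [mu_open]. *)
Definition Cc_positive_functional (R : realType) (X : topologicalType)
    (rho : (X -> R) -> \bar R) : Prop :=
  [/\ forall f, Cc f -> fle (cst 0%R) f -> 0 <= rho f,
      forall f g, Cc f -> Cc g -> fle (cst 0%R) g -> fle g f -> rho g <= rho f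
    & forall f g, Cc f -> Cc g -> (forall x, f x * g x = 0)%R ->
        fle (cst 0%R) f -> fle (cst 0%R) g -> rho (f \+ g)%R = rho f + rho g].

Lemma d_functional_Cc (R : realType) (X : topologicalType)
    (D : set (X -> R)) (rho : (X -> R) -> \bar R) :
  Cc `<=` D -> d_functional D rho -> Cc_positive_functional rho.
Proof.
move=> CcD [_ [D0 fin0] hom mono add].
(* [rho 0 = 2 * rho 0], and [rho 0] is finite. *)
have rho00 : rho (cst 0%R) = 0.
  have E : (fun x : X => 2 * cst 0 x)%R = cst (0 : R)%R.
    by apply/funext => x /=; rewrite mulr0.
  have := hom (cst 0%R) 2%R D0; rewrite E; move=> H.
  have {H} := H (fun=> lexx _) (ltr0n _ 2) D0.
  move: fin0; rewrite -fin_num_abs; case: (rho _) => // r _.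
  by rewrite -EFinM => -[] rE; congr EFin; lra.
split.
- by move=> f cf f0; rewrite -rho00; apply: mono => //; exact: CcD.
- by move=> f g cf cg; apply: mono; exact: CcD.
- move=> f g cf cg fg f0 g0; apply: add => //; try exact: CcD.
  by apply: CcD; exact: Cc_add.
Qed.

Section mu_rho_dtm.
Context {R : realType} {X : topologicalType} (rho : (X -> R) -> \bar R).
Context (hX : hausdorff_space X) (rhoP : Cc_positive_functional rho).
Implicit Types (f g : X -> R) (U V W : set X) (K C F : set X).

Lemma le_mu_open U f : test_fun U f -> rho f <= mu_open rho U.
Proof. by move=> Uf; apply: ereal_sup_ubound; exists f. Qed.

Lemma mu_open_le U (M : \bar R) :
  (forall f, test_fun U f -> rho f <= M) -> mu_open rho U <= M.
Proof. by move=> H; apply: ge_ereal_sup => _ [f Uf <-]; exact: H. Qed.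

Lemma rho_test_fun_ge0 U f : test_fun U f -> 0 <= rho f.
Proof. by case: rhoP => H _ _ [cf f0 _ _]; exact: H. Qed.

Lemma mu_open_ge0 U : 0 <= mu_open rho U.
Proof. exact: le_trans (rho_test_fun_ge0 (test_fun0 U)) (le_mu_open (test_fun0 U)). Qed.

Lemma test_funS U V f : U `<=` V -> test_fun U f -> test_fun V f.
Proof. by move=> UV [cf f0 f1 fU]; split=> //; exact: subset_trans fU UV. Qed.

Lemma mu_openS U V : U `<=` V -> mu_open rho U <= mu_open rho V.
Proof. by move=> UV; apply: mu_open_le => f /(test_funS UV); exact: le_mu_open. Qed.

Lemma mu_rho_ge0 (A : set X) : 0 <= mu_rho rho A.
Proof.
rewrite /mu_rho; case: ifP => _; first exact: mu_open_ge0.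
by apply: le_ereal_inf_tmp => _ [U _ <-]; exact: mu_open_ge0.
Qed.

Lemma mu_rho_le F U : closed F -> open U -> F `<=` U ->
  mu_rho rho F <= mu_open rho U.
Proof.
move=> cF oU FU; rewrite mu_rho_closedE//; apply: ereal_inf_lbound.
by exists U => //; rewrite mu_rho_openE.
Qed.

Lemma mu_rho_ge F (M : \bar R) : closed F ->
  (forall U, open U -> F `<=` U -> M <= mu_open rho U) -> M <= mu_rho rho F.
Proof.
move=> cF H; rewrite mu_rho_closedE//; apply: le_ereal_inf_tmp => _ [U [oU FU] <-].
by rewrite mu_rho_openE//; exact: H.
Qed.

Lemma le_mu_rhoD F (M t : \bar R) : closed F -> 0 <= t ->
  (forall U, open U -> F `<=` U -> M <= mu_open rho U + t) ->
  M <= mu_rho rho F + t.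
Proof.
move=> cF t0 H; rewrite mu_rho_closedE//; apply: ge0_ereal_infD_ge => //.
  by move=> _ [U [oU FU] <-]; exact: mu_rho_ge0.
by move=> _ [U [oU FU] <-]; rewrite mu_rho_openE//; exact: H.
Qed.

Lemma mu_openD_le U (M t : \bar R) : 0 <= t ->
  (forall f, test_fun U f -> rho f + t <= M) -> mu_open rho U + t <= M.
Proof.
move=> t0 H; apply: ge0_ereal_supD_le => //.
- by exists (rho (cst 0%R)), (cst 0%R) => //; exact: test_fun0.
- by move=> _ [f Uf <-]; exact: rho_test_fun_ge0 Uf.
- by move=> _ [f Uf <-]; exact: H.
Qed.

(** The restriction of [f] to [U] is continuous because it agrees with [f] on
    [U], with 0 on [V], and with 0 off the support of [f], and these open sets
    cover the space.  Its support is that of [f] minus [V]. *)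
Lemma test_fun_restrict U V f : open U -> open V -> U `&` V = set0 ->
  test_fun (U `|` V) f -> test_fun U (fun x => if `[< U x >] then f x else 0%R).
Proof.
move=> oU oV UV0 [[cf kf] f0 f1 fUV].
pose g x := if `[< U x >] then f x else 0%R.
have UV x : U x -> V x -> False.
  by move=> Ux Vx; have : (U `&` V) x by []; rewrite UV0.
have gU x : U x -> g x = f x by move=> Ux; rewrite /g asboolT.
have gN x : ~ U x -> g x = 0%R by move=> Ux; rewrite /g asboolF.
pose K := fsupp f `&` ~` V.
have gK : fsupp g `<=` K.
  apply: fsupp_sub.
    by apply: closedI; [exact: closed_closure|exact: open_closedC].
  move=> x gx; have Ux : U x by apply: contrapT => /gN g0; rewrite g0 eqxx in gx.
  split; last by move=> Vx; exact: UV Ux Vx.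
  by apply: subset_closure; rewrite /= -(gU x Ux).
split.
- apply: (CcP _ _ gK).
    apply: continuous_near_eq => x; have [Ux|nUx] := pselect (U x).
      exists f => //; have : nbhs x U by apply: open_nbhs_nbhs.
      by apply: filterS => y /gU.
    exists (cst 0%R); first exact: cst_continuous.
    have [Vx|nVx] := pselect (V x).
      have : nbhs x V by apply: open_nbhs_nbhs.
      by apply: filterS => y Vy; rewrite gN// => Uy; exact: UV Uy Vy.
    have : nbhs x (~` fsupp f).
      apply: open_nbhs_nbhs; split; last by move=> /fUV[].
      by apply: closed_openC; exact: closed_closure.
    apply: filterS => y /notin_fsupp fy.
    by have [/gU ->|/gN ->] := pselect (U y); rewrite ?fy.
  apply: (subclosed_compact _ kf); last by move=> x [].
  by apply: closedI; [exact: closed_closure|exact: open_closedC].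
- by move=> x; case: ifP => // _; exact: f0.
- by move=> x; case: ifP => // _; exact: f1.
- by move=> x /gK[/fUV[]].
Qed.

(** One inequality splits a function supported in the union into its two
    restrictions, the other adds up two functions with disjoint supports. *)
Lemma mu_openU U V : open U -> open V -> U `&` V = set0 ->
  mu_open rho (U `|` V) = mu_open rho U + mu_open rho V.
Proof.
move=> oU oV UV0; apply/eqP; rewrite eq_le; apply/andP; split.
  apply: mu_open_le => f UVf.
  have Uf := test_fun_restrict oU oV UV0 UVf.
  have Vf : test_fun V (fun x => if `[< V x >] then f x else 0%R).
    by apply: (test_fun_restrict oV oU); rewrite 1?setIC 1?setUC.
  set fU := (fun x => _) in Uf; set fV := (fun x => _) in Vf.
  have -> : f = (fU \+ fV)%R.
    apply/funext => x; rewrite /fU /fV /=.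
    case: asboolP => Ux; case: asboolP => Vx; rewrite ?addr0 ?add0r//.
      by have : (U `&` V) x by []; rewrite UV0.
    by apply: notin_fsupp => fx; case: UVf => _ _ _ /(_ _ fx) [].
  case: (Uf) (Vf) => [cU U0 _ _] [cV V0 _ _].
  have -> : rho (fU \+ fV)%R = rho fU + rho fV.
    case: rhoP => _ _; apply => // x; rewrite /fU /fV.
    case: asboolP => Ux; case: asboolP => Vx; rewrite ?mulr0 ?mul0r//.
    by have : (U `&` V) x by []; rewrite UV0.
  by apply: leeD; exact: le_mu_open.
apply: mu_openD_le; first exact: mu_open_ge0.
move=> f Uf; rewrite addeC; apply: mu_openD_le; first exact: rho_test_fun_ge0 Uf.
move=> g Vg; rewrite addeC.
case: (Uf) (Vg) => [cf f0 f1 fU] [cg g0 g1 gV].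
have fg x : f x = 0%R \/ g x = 0%R.
  have [/notin_fsupp|] := pselect (~ fsupp f x); first by left.
  move=> /contrapT/fU Ux; right; apply: notin_fsupp => /gV Vx.
  by have : (U `&` V) x by []; rewrite UV0.
have <- : rho (f \+ g)%R = rho f + rho g.
  case: rhoP => _ _; apply => // x.
  by have [->|->] := fg x; rewrite ?mulr0 ?mul0r.
apply: le_mu_open; split.
- exact: Cc_add.
- by move=> x; apply: addr_ge0; [exact: f0|exact: g0].
- by move=> x; rewrite /=; have [->|->] := fg x; rewrite ?add0r ?addr0; [exact: g1|exact: f1].
- have : fsupp (f \+ g)%R `<=` fsupp f `|` fsupp g.
    apply: fsupp_sub; first by apply: closedU; exact: closed_closure.
    move=> x; apply: contraNP => /not_orP[/notin_fsupp fx /notin_fsupp gx].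
    by rewrite /= fx gx addr0.
  by move=> /subset_trans; apply; exact: setUSS.
Qed.

Lemma mu_rho_inner_compact : inner_compact_regular (mu_rho rho).
Proof.
move=> U oU; apply/eqP; rewrite eq_le; apply/andP; split.
  rewrite mu_rho_openE//; apply: mu_open_le => f [[cf kf] f0 f1 fU].
  apply: le_ereal_sup_tmp; exists (mu_rho rho (fsupp f)).
    by exists (fsupp f).
  apply: mu_rho_ge; first exact: closed_closure.
  by move=> V _ fV; apply: le_mu_open.
apply: ge_ereal_sup => _ [C [kC CU] <-]; rewrite (mu_rho_openE rho oU).
by apply: mu_rho_le => //; exact: compact_closed.
Qed.

Lemma compact_open_separation C K : compact C -> compact K -> C `&` K = set0 ->
  locally_compact [set: X] ->
  exists U V, [/\ open U, open V, C `<=` U, K `<=` V & U `&` V = set0].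
Proof.
move=> kC kK CK lX.
have CnK : C `<=` ~` K by apply/disjoints_subset.
have [g [W [[_ _ _ gK] oW CW g1]]] := @lch_urysohn R X C (~` K) hX lX kC
  (closed_openC (compact_closed hX kK)) CnK.
exists W, (~` fsupp g); split => //.
- by apply: closed_openC; exact: closed_closure.
- by move=> x Kx /gK.
- apply/seteqP; split=> // x [Wx]; apply; apply: subset_closure => /=.
  by rewrite g1// oner_eq0.
Qed.

(** Neighbourhoods of the two compact sets can be shrunk to be disjoint, and
    then additivity on disjoint open sets applies. *)
Lemma mu_rho_compactU (lX : locally_compact [set: X]) C K :
  compact C -> compact K -> C `&` K = set0 ->
  mu_rho rho (C `|` K) = mu_rho rho C + mu_rho rho K.
Proof.
move=> kC kK CK0.
have [U [V [oU oV CU KV UV0]]] := compact_open_separation kC kK CK0 lX.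
have [cC cK] := (compact_closed hX kC, compact_closed hX kK).
have WUV W W' : (W `&` U) `&` (W' `&` V) = set0.
  by rewrite setIACA UV0 setI0.
apply/eqP; rewrite eq_le; apply/andP; split.
  apply: le_mu_rhoD => //; first exact: mu_rho_ge0.
  move=> W oW CW; rewrite addeC; apply: le_mu_rhoD => //; first exact: mu_open_ge0.
  move=> W' oW' KW'.
  apply: (@le_trans _ _ (mu_open rho ((W `&` U) `|` (W' `&` V)))).
    apply: mu_rho_le; first exact: closedU.
      by apply: openU; exact: openI.
    by apply: setUSS => x H; split; auto.
  rewrite mu_openU//; [|exact: openI|exact: openI].
  by rewrite addeC; apply: leeD; apply: mu_openS => x [].
apply: mu_rho_ge; first exact: closedU.
move=> W oW CKW.
apply: (@le_trans _ _ (mu_open rho ((W `&` U) `|` (W `&` V)))).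
  rewrite mu_openU//; [|exact: openI|exact: openI].
  apply: leeD; apply: mu_rho_le => //; try exact: openI.
    by move=> x Cx; split; [apply: CKW; left|exact: CU].
  by move=> x Kx; split; [apply: CKW; right|exact: KV].
by apply: mu_openS => x [] [].
Qed.

Lemma mu_rho_dtm : locally_compact [set: X] ->
  deficient_topological_measure (mu_rho rho).
Proof.
move=> lX; split.
- by move=> A _; exact: mu_rho_ge0.
- exact: mu_rho_compactU.
- exact: mu_rho_inner_compact.
- by move=> F cF; exact: mu_rho_closedE.
Qed.

End mu_rho_dtm.

(** * From additivity over a plateau to a topological measure *)

(** [phi] has a plateau at height 1 which contains all points where [g] is
    nonzero, so [g] sits under the plateau and [phi - g] is again between 0 and
    1.  The product of [g] and [phi - g] need not vanish: this is more than
    orthogonal additivity. *)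
Definition plateau_additive (R : realType) (X : topologicalType)
    (rho : (X -> R) -> \bar R) : Prop :=
  forall phi g, Cc phi -> Cc g -> fle (cst 0%R) phi -> fle phi (cst 1%R) ->
    fle (cst 0%R) g -> fle g (cst 1%R) ->
    (forall x, g x != 0%R -> phi x = 1%R) ->
    rho phi = rho g + rho (phi \- g)%R.

Section plateau_additive_tm.
Context {R : realType} {X : topologicalType} (rho : (X -> R) -> \bar R).
Context (hX : hausdorff_space X) (lX : locally_compact [set: X]).
Context (rhoP : Cc_positive_functional rho) (rhoA : plateau_additive rho).
Implicit Types (f g : X -> R) (U V W : set X) (K C F : set X).

Lemma mu_open_split U C : open U -> compact C -> C `<=` U ->
  mu_open rho U <= mu_rho rho C + mu_open rho (U `\` C).
Proof.
move=> oU kC CU.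
apply: le_mu_rhoD => //; [exact: compact_closed|exact: mu_open_ge0|].
move=> V oV CV; apply: mu_open_le => f [[cf kf] f0 f1 fU].
have CUV : C `<=` U `&` V by move=> x Cx; split; auto.
(* [g] cuts off a neighbourhood of [C] within [V]; then [phi] cuts off a
   neighbourhood, within [U], of the supports of [f] and [g]. *)
have [g [W [[[cg kg] g0 g1 gUV] oW CW gW]]] :=
  @lch_urysohn R X C (U `&` V) hX lX kC (openI oU oV) CUV.
have fgU : fsupp f `|` fsupp g `<=` U by move=> x [/fU|/gUV[]].
have [phi [W' [[cphi p0 p1 pU] _ fgW pW]]] :=
  @lch_urysohn R X _ U hX lX (compactU kf kg) oU fgU.
have pg x : g x != 0%R -> phi x = 1%R.
  by move=> gx; apply/pW/fgW; right; exact: subset_closure.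
apply: (@le_trans _ _ (rho phi)).
  case: rhoP => _ mono _; apply: mono => // x.
  have [fx|/notin_fsupp ->] := pselect (fsupp f x); last exact: p0.
  by rewrite (pW x); [exact: f1|apply: fgW; left].
rewrite (rhoA cphi (conj cg kg) p0 p1 g0 g1 pg); apply: leeD; apply: le_mu_open.
  by split => //; move=> x /gUV[].
have sub : fsupp (phi \- g)%R `<=` fsupp phi `&` ~` W.
  apply: fsupp_sub.
    by apply: closedI; [exact: closed_closure|exact: open_closedC].
  move=> x /= pgx; split.
    apply: contrapT => /notin_fsupp px; move: pgx; rewrite px sub0r oppr_eq0.
    by move=> /pg; rewrite px => /eqP; rewrite eq_sym oner_eq0.
  by move=> Wx; move: pgx; rewrite (gW _ Wx) pg ?subrr ?eqxx// (gW _ Wx) oner_eq0.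
split.
- exact: Cc_sub.
- move=> x /=; rewrite subr_ge0; have [->|/pg ->] := eqVneq (g x) 0%R.
    exact: p0.
  exact: g1.
- by move=> x /=; rewrite lerBlDr (le_trans (p1 x))//= lerDl; exact: g0.
- by move=> x /sub[/pU Ux nWx]; split=> // /CW.
Qed.

(** A compact subset of [V] is disjoint from [K], so this follows from
    additivity on compact sets and inner regularity on [V]. *)
Lemma mu_rho_superadditive K V U : compact K -> open V -> open U ->
  K `&` V = set0 -> K `|` V `<=` U ->
  mu_rho rho K + mu_open rho V <= mu_open rho U.
Proof.
move=> kK oV oU KV0 KVU.
rewrite addeC -(mu_rho_openE rho oV) (mu_rho_inner_compact rho hX)//.
apply: ge0_ereal_supD_le.
- by exists (mu_rho rho set0), set0 => //; split; [exact: compact0|].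
- by move=> _ [C _ <-]; exact: mu_rho_ge0.
- exact: mu_rho_ge0.
- move=> _ [C [kC CV] <-]; rewrite -(mu_rho_compactU hX rhoP lX)//.
    apply: mu_rho_le => //.
      by apply: closedU; exact: compact_closed.
    by move=> x [/CV|] H; apply: KVU; [right|left].
  apply/seteqP; split=> // x [/CV Vx Kx].
  by have : (K `&` V) x by []; rewrite KV0.
Qed.

(** If the union is open, the upper bound is [mu_open_split] itself.  If the
    union is compact, let [U] be a neighbourhood of [K]: then [L = V \ U] is
    compact, since it is the union minus [U], and it can be split off the open
    set [U] + [V], which leaves a subset of [U]. *)
Lemma mu_rho_compact_openU K V : compact K -> open V -> K `&` V = set0 ->
  compact (K `|` V) \/ open (K `|` V) ->
  mu_rho rho (K `|` V) = mu_rho rho K + mu_rho rho V.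
Proof.
move=> kK oV KV0; rewrite (mu_rho_openE rho oV).
have cK := compact_closed hX kK.
have KVF x : K x -> V x -> False.
  by move=> Kx Vx; have : (K `&` V) x by []; rewrite KV0.
move=> [kU|oU]; apply/eqP; rewrite eq_le; apply/andP; split.
- have cU := compact_closed hX kU.
  apply: le_mu_rhoD => //; first exact: mu_open_ge0.
  move=> U oU KU; pose L := (K `|` V) `&` ~` U.
  have kL : compact L.
    apply: (subclosed_compact _ kU); last by move=> x [].
    by apply: closedI => //; exact: open_closedC.
  have LV : L `<=` V by move=> x [[/KU|//]].
  apply: (@le_trans _ _ (mu_open rho (U `|` V))).
    by apply: mu_rho_le => //; [exact: openU|exact: setSU].
  have LUV : L `<=` U `|` V by move=> x /LV; right.
  apply: (le_trans (mu_open_split (openU oU oV) kL LUV)).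
  rewrite addeC; apply: leeD.
    apply: mu_openS => x [[//|Vx] nLx]; apply: contrapT => nUx; apply: nLx.
    by split=> //; right.
  by apply: mu_rho_le => //; exact: compact_closed.
- apply: mu_rho_ge; first exact: compact_closed.
  by move=> U oU; exact: mu_rho_superadditive.
- rewrite (mu_rho_openE rho oU).
  have KU : K `<=` K `|` V by move=> x; left.
  apply: (le_trans (mu_open_split oU kK KU)).
  by apply: leeD => //; apply: mu_openS => x [[]].
- by rewrite (mu_rho_openE rho oU); exact: mu_rho_superadditive.
Qed.

Lemma mu_rho_tm : topological_measure (mu_rho rho).
Proof.
have [ge0 addC inn out] := mu_rho_dtm hX rhoP lX.
split=> // A B [kA|oA] [kB|oB] AUB AB0.
- exact: addC.
- exact: mu_rho_compact_openU.
- by rewrite setUC addeC; apply: mu_rho_compact_openU; rewrite 1?setIC 1?setUC.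
- by rewrite !mu_rho_openE//; [exact: mu_openU|exact: openU].
Qed.

End plateau_additive_tm.

(** * The two sources of additivity over a plateau *)

(** With [d = phi - g], one has [1 - d = (1 - phi) + g], a sum of nonnegative
    functions with product 0.  The constant condition turns [rho (1 - d)] into
    [rho 1 - rho d], and likewise for [phi]. *)
Lemma s_functional_plateau_additive (R : realType) (X : topologicalType)
    (D : set (X -> R)) (rho : (X -> R) -> \bar R) :
  Cc `<=` D -> (forall c : R, D (cst c)) -> s_functional D rho ->
  constant_condition D rho -> plateau_additive rho.
Proof.
move=> CcD Dc [real hom mono add] cc phi g cp cg p0 p1 g0 g1 pg.
have neg f : Cc f -> fle (cst 0%R) f -> rho (fun x => -1 * f x)%R = - rho f.
  move=> cf f0; rewrite hom; [|exact: CcD|exact: f0|].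
    by rewrite EFinN mulN1e.
  by apply: CcD; exact: Cc_scale.
pose d := (phi \- g)%R.
have d0 : fle (cst 0%R) d.
  move=> x; rewrite /d /= subr_ge0.
  by have [->|/pg ->] := eqVneq (g x) 0%R; [exact: p0|exact: g1].
have cd : Cc d by exact: Cc_sub.
pose np := (fun x => -1 * phi x)%R; pose nd := (fun x => -1 * d x)%R.
have [Dp Ep] := cc np 1%R (CcD _ (Cc_scale (-1) cp)).
have [Dd Ed] := cc nd 1%R (CcD _ (Cc_scale (-1) cd)).
have E : (nd \+ cst 1 = (np \+ cst 1) \+ g)%R.
  by apply/funext => x /=; rewrite /nd /np /d /=; ring.
have : rho (nd \+ cst 1)%R = rho (np \+ cst 1)%R + rho g.
  rewrite E; apply: add => //; [exact: CcD| |left; split=> //|].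
  - move=> x; rewrite /np /=.
    by have [->|/pg ->] := eqVneq (g x) 0%R; ring.
  - by move=> x; rewrite /np /= mulN1r addrC subr_ge0; exact: p1.
  - by rewrite -E.
rewrite Ep Ed /np /nd !neg//.
have := real _ (Dc 1%R); have := real _ (CcD _ cp); have := real _ (CcD _ cg).
have := real _ (CcD _ cd); rewrite -/d.
case: (rho phi) => // a; case: (rho g) => // b; case: (rho d) => // c.
case: (rho (cst 1%R)) => // e _ _ _ _.
by rewrite -!EFinN -!EFinD => -[] H; congr EFin; lra.
Qed.

(** Polynomial approximations, without constant term, of the tent function
    [1 - |1 - t|] on [0, 2].  In terms of [p n = 1 - tent_poly n] the recursion
    is [p n.+1 = p n + ((1 - t)^2 - (p n)^2) / 2], the classical iteration for
    the square root of [(1 - t)^2]; starting it at the constant 1 keeps all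
    iterates equal to 1 at [t = 0], so that no constant term appears.  This
    matters because the constant 1 need not be in the generated subalgebra. *)
Fixpoint tent_poly (R : realType) (n : nat) (t : R) : R :=
  (if n is m.+1 then t - t ^+ 2 / 2 + tent_poly m t ^+ 2 / 2 else 0)%R.

(** With [w = |1 - t|], the error [e] becomes [e * (1 - w - e / 2)], hence at
    most [e - e^2 / 2], at each step, and the sequence [2 / (n + 2)] decreases
    no faster than this recursion. *)
Lemma tent_poly_cvg (R : realType) (n : nat) (t : R) :
  (0 <= t <= 2 ->
   0 <= (1 - `|1 - t|) - tent_poly n t <= 2 / (n.+2)%:R)%R.
Proof.
move=> t02; have : (0 <= tent_poly n t /\
  0 <= (1 - `|1 - t|) - tent_poly n t <= 2 / (n.+2)%:R)%R; last by case.
set w := (`|1 - t|)%R.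
have w0 : (0 <= w)%R by exact: normr_ge0.
have w1 : (w <= 1)%R by rewrite /w ler_norml; lra.
have w2 : (w ^+ 2 = (1 - t) ^+ 2)%R by exact: real_normK (num_real _).
elim: n => [|n [a0 /andP[e0 eb]]] /=.
  by rewrite subr0 divff//; lra.
move: (tent_poly n t) a0 e0 eb => a a0 e0 eb.
split; first by nra.
have -> : (1 - w - (t - t ^+ 2 / 2 + a ^+ 2 / 2) =
   (1 - w - a) * (1 - w + a) / 2)%R by lra.
have {}e0 : (a <= 1 - w)%R by lra.
apply/andP; split; first by nra.
pose b : R := (2 / (n.+2)%:R)%R.
have m0 : (0 <= n%:R :> R)%R by exact: ler0n.
have bE : (b * (n%:R + 2) = 2)%R.
  by rewrite /b -(natrD _ n 2) addn2 divfK// pnatr_eq0.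
have b1 : (0 <= b <= 1)%R by nra.
(* [x - x^2 / 2] is nondecreasing on [0, 1], where both [e] and [b] lie. *)
apply: (@le_trans _ _ (b - b ^+ 2 / 2)%R).
  have : (1 - w - a <= b)%R by exact: eb.
  by nra.
rewrite ler_pdivlMr ?ltr0n// -addn3 natrD.
by nra.
Qed.

Lemma uniform_closure (R : realType) (X : topologicalType)
    (A : set (X -> R)) (f : X -> R) :
  (forall e : R, (0 < e)%R ->
    exists2 g, A g & forall x, (`|f x - g x| < e)%R) ->
  closure (A : set {uniform X -> R}) f.
Proof.
move=> H P /uniform_nbhs[E [entE EP]].
move: entE; rewrite -entourage_ballE => -[e /= e0 eE].
have [g Ag fg] := H e e0; exists g; split => //.
by apply: EP => y _; apply: eE; exact: fg.
Qed.

Lemma tent_gen_subalgebra (R : realType) (X : topologicalType)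
    (B : set (X -> R)) (h : X -> R) :
  (forall x, 0 <= h x <= 2)%R -> B (fun x => 1 - `|1 - h x|)%R ->
  gen_subalgebra B h (fun x => 1 - `|1 - h x|)%R.
Proof.
move=> h02 Bf A AB [A0 AD AM AZ] Acl Ah _; apply: Acl; split=> //.
apply: uniform_closure => e e0.
have An n : A (fun x => tent_poly n (h x)).
  elim: n => [|n IHn] //=.
  have -> : (fun x => h x - h x ^+ 2 / 2 + tent_poly n (h x) ^+ 2 / 2)%R =
    ((h \+ (fun x => - 2^-1 * (h \* h) x)) \+
      (fun x => 2^-1 * ((fun x => tent_poly n (h x)) \*
                        (fun x => tent_poly n (h x))) x))%R.
    by apply/funext => x /=; ring.
  by apply: (AD _ _ (AD _ _ Ah (AZ _ _ (AM _ _ Ah Ah))) (AZ _ _ (AM _ _ IHn IHn))).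
have [n en] : exists n : nat, (2 / (n.+2)%:R < e)%R.
  exists (Num.bound (2 / e)); set n := Num.bound _.
  have : (2 / e < n%:R)%R.
    by apply: archi_boundP; apply: divr_ge0 => //; exact: ltW.
  rewrite ltr_pdivrMr// ltr_pdivrMr ?ltr0n// -addn2 natrD; nra.
exists (fun x => tent_poly n (h x)) => // x.
have /andP[p0 pe] := tent_poly_cvg n (h02 x).
by rewrite ger0_norm//; exact: le_lt_trans pe en.
Qed.

Lemma quasi_linear_plateau_additive (R : realType) (X : topologicalType)
    (D : set (X -> R)) (rho : (X -> R) -> \bar R) :
  quasi_linear_functional D rho -> plateau_additive rho.
Proof.
move=> [[algD _ CcD] _ _ add _] phi g cp cg p0 p1 g0 g1 pg.
pose h := (phi \+ g)%R; pose d := (phi \- g)%R.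
have ch : Cc h by exact: Cc_add.
have h02 x : (0 <= h x <= 2)%R.
  by have := p0 x; have := p1 x; have := g0 x; have := g1 x; rewrite /h /=; lra.
(* Where [g] vanishes, [h = phi <= 1] and [d = h]; elsewhere [h = 1 + g] and
   [d = 1 - g]. *)
have dE : (fun x => 1 - `|1 - h x|)%R = d.
  apply/funext => x; rewrite /d /h /=; have := p1 x; have := g0 x => /=.
  have [-> _ px|/pg -> gx _] := eqVneq (g x) 0%R.
    by rewrite ger0_norm; lra.
  by rewrite ler0_norm; lra.
have genh : gen_subalgebra D h h by move=> A.
have gend : gen_subalgebra D h d.
  by rewrite -dE; apply: tent_gen_subalgebra => //; rewrite dE; apply/CcD/Cc_sub.
have geng : gen_subalgebra D h g.
  move=> A AD sA clA Ah A1; have [_ addA _ scaleA] := sA.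
  have -> : g = (fun x => 2^-1 * (h \+ (fun x => -1 * d x)) x)%R.
    by apply/funext => x; rewrite /h /d /=; field.
  by apply/scaleA/addA => //; apply: scaleA; exact: gend.
rewrite -(add h) //; last exact: CcD.
by congr rho; apply/funext => x /=; ring.
Qed.

(** * The theorem *)

Theorem theorem5p4 (R : realType) (X : topologicalType)
    (hausX : hausdorff_space X)
    (lcX : locally_compact [set: X])
    (connX : connected [set: X])
    (D : set (X -> R)) (rho : (X -> R) -> \bar R)
    (CcD : Cc `<=` D) (DCb : D `<=` Cb)
    (drho : d_functional D rho) :
  [/\ (* (i) *)
      deficient_topological_measure (mu_rho rho),
      (* (ii) *)
      real_valued_on rho Cc ->
        forall K : set X, compact K -> mu_rho rho K < +oo,
      (* (iii) *)
      bounded_functional D rho -> mu_rho rho [set: X] < +oo,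
      (* (iv) *)
      compact [set: X] -> D = Cfun ->
        mu_rho rho [set: X] = rho (cst 1%R)
    & (* (v) *)
      ((forall c : R, D (cst c)) -> rho (cst 1%R) \is a fin_num ->
        s_functional D rho -> constant_condition D rho ->
        topological_measure (mu_rho rho)) /\
      (* (vi) *)
      (quasi_linear_functional D rho -> topological_measure (mu_rho rho))].
Proof.
have rhoP := d_functional_Cc CcD drho.
split; [exact: mu_rho_dtm| | | |split].
- move=> fin K kK.
  have [g [W [[cg g0 g1 _] oW KW gW]]] :=
    @lch_urysohn R X K [set: X] hausX lcX kK openT (@subsetT _ K).
  have : rho g < +oo by rewrite ltey_eq fin.
  apply: le_lt_trans; apply: (@le_trans _ _ (mu_open rho W)).
    by apply: mu_rho_le => //; exact: compact_closed.
  apply: mu_open_le => f [cf f0 f1 fW]; case: rhoP => _ mono _; apply: mono => // x.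
  have [/fW Wx|/notin_fsupp ->] := pselect (fsupp f x); last exact: g0.
  by rewrite gW//; exact: f1.
- move=> bd; rewrite mu_rho_openE; last exact: openT.
  apply: le_lt_trans bd; apply: mu_open_le => f [cf f0 f1 _].
  apply: (@le_trans _ _ `|rho f|); first exact: lee_abs.
  apply: ereal_sup_ubound; exists f => //; split; first exact: CcD.
  apply: ge_ereal_sup => _ [x _ <-].
  by rewrite abse_EFin lee_fin ger0_norm; [exact: f1|exact: f0].
- move=> kX _; rewrite mu_rho_openE; last exact: openT.
  have c1 : Cc (cst 1%R : X -> R).
    by apply: (CcP _ kX) => //; exact: cst_continuous.
  apply/eqP; rewrite eq_le; apply/andP; split.
    apply: mu_open_le => f [cf f0 f1 _].
    by case: rhoP => _ mono _; exact: mono.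
  by apply: le_mu_open; split => // x; exact: ler01.
- move=> Dc _ sf cc; apply: mu_rho_tm => //.
  exact: s_functional_plateau_additive sf cc.
- by move=> ql; apply: mu_rho_tm => //; exact: quasi_linear_plateau_additive ql.
Qed.
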